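(* Let $n\in\mathbb{N}$ and let $PR(n)$ be the planar rook algebra over $\mathbb{C}$. Then the Plesken Lie algebra $\mathcal{L}(PR(n))$ with respect to the anti-involution given by reflecting diagrams (swapping top and bottom rows) satisfies, as a complex Lie algebra, $$\mathcal{L}(PR(n))\cong\bigoplus_{k=0}^{n}\mathfrak{o}\left(\binom{n}{k},\mathbb{C}\right).$$
   Context: An anti-involution of an associative $K$-algebra $A$ is a $K$-linear map $\sigma:A\to A$ with $\sigma(ab)=\sigma(b)\sigma(a)$ for all $a,b\in A$ and $\sigma^2=\mathrm{id}_A$. The Plesken Lie algebra of $A$ with respect to $\sigma$ is the subspace $\mathcal{L}(A)=\mathrm{span}\{a-\sigma(a)\mid a\in A\}$ of $A$, with Lie bracket $[x,y]=xy-yx$; this is a Lie subalgebra of $A$ equipped with the commutator bracket. Planar rook algebra: consider diagrams with $n$ nodes in a top row and $n$ nodes in a bottom row. An arc connects a node of the top row with a node of the bottom row. A planar rook diagram is a set of arcs (possibly empty) which can be drawn without crossings and without common endpoints. Thus a planar rook diagram is uniquely determined by two subsets $s,t\subseteq\{1,\dots,n\}$ of equal size (the endpoints of the arcs in the top row and in the bottom row), the arcs joining the elements of $s$ to those of $t$ in increasing order. The algebra $PR(n)$ over a field $K$ is the $K$-vector space with basis all planar rook diagrams, with multiplication the bilinear extension of concatenation: the product $d_1d_2$ is obtained by placing $d_1$ on top of $d_2$, identifying the bottom row of $d_1$ with the top row of $d_2$; it has an arc from top node $a$ to bottom node $c$ precisely when there is a middle node $b$ such that $d_1$ has an arc from $a$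 to $b$ and $d_2$ has an arc from $b$ to $c$. The reflection anti-involution is the linear map that swaps the top and bottom rows of each diagram. For $m\ge 1$, $\mathfrak{o}(m,\mathbb{C})$ is the Lie algebra of skew-symmetric complex $m\times m$ matrices with the commutator bracket. *)

(* Defs.v *)
From HB Require Import structures.
From mathcomp Require Import all_boot all_order all_algebra.
From mathcomp Require Import boolp classical_sets reals complex.

Set Implicit Arguments.
Unset Strict Implicit.
Unset Printing Implicit Defensive.

Import Order.TTheory GRing.Theory Num.Theory.

Local Open Scope ring_scope.

HB.mixin Record Lmodule_isLieAlgebra (K : fieldType) L of GRing.Lmodule K L := {
  lie : L -> L -> L;
  lie_linearl : forall a x y z, lie (a *: x + y) z = a *: lie x z + lie y z;
  lie_linearr : forall a x y z, lie z (a *: x + y) = a *: lie z x + lie z y;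
  liexx : forall x, lie x x = 0;
  lie_jacobi : forall x y z,
    lie x (lie y z) + lie y (lie z x) + lie z (lie x y) = 0
}.

#[short(type="lieAlgType")]
HB.structure Definition LieAlgebra (K : fieldType) :=
  {L of GRing.Lmodule K L & Lmodule_isLieAlgebra K L}.

Definition lie_isomorphic (K : fieldType) (L1 L2 : lieAlgType K) : Prop :=
  exists f : {linear L1 -> L2},
    bijective f /\ forall x y, f (lie x y) = lie (f x) (f y).

Section DirectSum.
Variables (K : fieldType) (I : finType) (L : I -> lieAlgType K).

(* Over a finite index set the direct sum is the product, with componentwise
   operations. *)
Definition lie_dsum : Type := {dffun forall i : I, L i}.

HB.instance Definition _ := Choice.on lie_dsum.

Implicit Types f g h : lie_dsum.

Definition dsum_zero : lie_dsum := [ffun i : I => 0 : L i].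
Definition dsum_opp f : lie_dsum := [ffun i : I => - f i].
Definition dsum_add f g : lie_dsum := [ffun i : I => f i + g i].
Definition dsum_scale (a : K) f : lie_dsum := [ffun i : I => a *: f i].
Definition dsum_lie f g : lie_dsum := [ffun i : I => lie (f i) (g i)].

Fact dsum_addA : associative dsum_add.
Proof. by move=> f g h; apply/ffunP=> i; rewrite !ffunE addrA. Qed.
Fact dsum_addC : commutative dsum_add.
Proof. by move=> f g; apply/ffunP=> i; rewrite !ffunE addrC. Qed.
Fact dsum_add0 : left_id dsum_zero dsum_add.
Proof. by move=> f; apply/ffunP=> i; rewrite !ffunE add0r. Qed.
Fact dsum_addN : left_inverse dsum_zero dsum_opp dsum_add.
Proof. by move=> f; apply/ffunP=> i; rewrite !ffunE addNr. Qed.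

HB.instance Definition _ := GRing.isZmodule.Build lie_dsum
  dsum_addA dsum_addC dsum_add0 dsum_addN.

Fact dsum_scaleA a b f : dsum_scale a (dsum_scale b f) = dsum_scale (a * b) f.
Proof. by apply/ffunP=> i; rewrite !ffunE scalerA. Qed.
Fact dsum_scale1 : left_id 1 dsum_scale.
Proof. by move=> f; apply/ffunP=> i; rewrite !ffunE scale1r. Qed.
Fact dsum_scaleDr : right_distributive dsum_scale +%R.
Proof. by move=> a f g; apply/ffunP=> i; rewrite !ffunE scalerDr. Qed.
Fact dsum_scaleDl f : {morph dsum_scale^~ f : a b / a + b}.
Proof. by move=> a b; apply/ffunP=> i; rewrite !ffunE scalerDl. Qed.

HB.instance Definition _ := GRing.Zmodule_isLmodule.Build K lie_dsum
  dsum_scaleA dsum_scale1 dsum_scaleDr dsum_scaleDl.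

Fact dsum_lie_linearl a f g h :
  dsum_lie (a *: f + g) h = a *: dsum_lie f h + dsum_lie g h.
Proof. by apply/ffunP=> i; rewrite !ffunE lie_linearl. Qed.
Fact dsum_lie_linearr a f g h :
  dsum_lie h (a *: f + g) = a *: dsum_lie h f + dsum_lie h g.
Proof. by apply/ffunP=> i; rewrite !ffunE lie_linearr. Qed.
Fact dsum_liexx f : dsum_lie f f = 0.
Proof. by apply/ffunP=> i; rewrite !ffunE liexx. Qed.
Fact dsum_lie_jacobi f g h :
  dsum_lie f (dsum_lie g h) + dsum_lie g (dsum_lie h f) +
    dsum_lie h (dsum_lie f g) = 0.
Proof. by apply/ffunP=> i; rewrite !ffunE lie_jacobi. Qed.

HB.instance Definition _ := Lmodule_isLieAlgebra.Build K lie_dsum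
  dsum_lie_linearl dsum_lie_linearr dsum_liexx dsum_lie_jacobi.

End DirectSum.

Section Commutator.
Variable A : pzRingType.
Implicit Types x y z : A.

Definition commutator x y : A := x * y - y * x.

Lemma commutatorDl x y z :
  commutator (x + y) z = commutator x z + commutator y z.
Proof. by rewrite /commutator mulrDl mulrDr opprD addrACA. Qed.
Lemma commutatorDr x y z :
  commutator z (x + y) = commutator z x + commutator z y.
Proof. by rewrite /commutator mulrDl mulrDr opprD addrACA. Qed.
Lemma commutatorxx x : commutator x x = 0.
Proof. exact: subrr. Qed.
Lemma commutator_jacobi x y z :
  commutator x (commutator y z) + commutator y (commutator z x) +
    commutator z (commutator x y) = 0.
Proof.
rewrite /commutator !mulrBl !mulrBr !mulrA !opprB.
rewrite [LHS](AC ((((2*2)*(2*2))*(2*2)))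
  ((1*12)*(7*2)*(3*10)*(5*4)*(9*8)*(11*6)))/=.
by rewrite !subrr !addr0.
Qed.

End Commutator.

Section Orthogonal.
Variables (K : fieldType) (m : nat).

Definition skew_symmetric : pred 'M[K]_m := fun X => X^T == - X.

Fact skew_symmetric_submod_closed : submod_closed skew_symmetric.
Proof.
split=> [|a X Y /eqP XT /eqP YT]; first by rewrite unfold_in trmx0 oppr0.
by rewrite unfold_in linearP /= XT YT scalerN opprD.
Qed.
HB.instance Definition _ := GRing.isSubmodClosed.Build K 'M[K]_m skew_symmetric
  skew_symmetric_submod_closed.

Record lie_o : Type :=
  LieO { orth_val :> 'M[K]_m; _ : skew_symmetric orth_val }.

HB.instance Definition _ := [isSub for orth_val].
HB.instance Definition _ := [Choice of lie_o by <:].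
HB.instance Definition _ := [SubChoice_isSubLmodule of lie_o by <:].

Implicit Types X Y Z : lie_o.

Fact orth_lie_subproof X Y :
  skew_symmetric (orth_val X *m orth_val Y - orth_val Y *m orth_val X).
Proof.
case: X Y => [X /eqP XT] [Y /eqP YT] /=; apply/eqP.
by rewrite linearB /= !trmx_mul XT YT !(mulmxN, mulNmx) !opprK opprB.
Qed.
Definition orth_lie X Y : lie_o := LieO (orth_lie_subproof X Y).

Fact orth_lie_linearl a X Y Z :
  orth_lie (a *: X + Y) Z = a *: orth_lie X Z + orth_lie Y Z.
Proof.
apply: val_inj; rewrite [LHS]/= [RHS]linearP /=.
rewrite mulmxDl mulmxDr -scalemxAl -scalemxAr.
by rewrite opprD addrACA -scalerBr.
Qed.
Fact orth_lie_linearr a X Y Z :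
  orth_lie Z (a *: X + Y) = a *: orth_lie Z X + orth_lie Z Y.
Proof.
apply: val_inj; rewrite [LHS]/= [RHS]linearP /=.
rewrite mulmxDl mulmxDr -scalemxAl -scalemxAr.
by rewrite opprD addrACA -scalerBr.
Qed.
Fact orth_liexx X : orth_lie X X = 0.
Proof. by apply: val_inj; rewrite /= subrr. Qed.
Fact orth_lie_jacobi X Y Z :
  orth_lie X (orth_lie Y Z) + orth_lie Y (orth_lie Z X) +
    orth_lie Z (orth_lie X Y) = 0.
Proof. by apply: val_inj; apply: (@commutator_jacobi 'M[K]_m). Qed.

HB.instance Definition _ := Lmodule_isLieAlgebra.Build K lie_o
  orth_lie_linearl orth_lie_linearr orth_liexx orth_lie_jacobi.

End Orthogonal.

#[local] Open Scope classical_set_scope.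

Definition lin_span (K : fieldType) (V : lmodType K) (S : set V) : set V :=
  [set x | exists (m : nat) (c : 'I_m -> K) (v : 'I_m -> V),
    (forall i, S (v i)) /\ x = \sum_(i < m) c i *: v i].

HB.mixin Record isAntiInvolution (K : fieldType) (A : algType K)
    (sigma : A -> A) := {
  antiinvM : forall a b, sigma (a * b) = sigma b * sigma a;
  antiinvK : involutive sigma
}.

#[short(type="antiInvolution")]
HB.structure Definition AntiInvolution (K : fieldType) (A : algType K) :=
  {sigma of @GRing.Linear K A A *:%R sigma & isAntiInvolution K A sigma}.

Section Plesken.
Variables (K : fieldType) (A : algType K) (sigma : antiInvolution A).

Definition plesken_set : set A := lin_span (range (fun a : A => a - sigma a)).

Definition plesken_pred : pred A := fun x => `[< plesken_set x >].

Fact plesken_submod_closed : submod_closed plesken_pred.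
Proof.
split=> [|a x y /asboolP [m [c [v [vS ->]]]] /asboolP [p [d [w [wS ->]]]]].
  apply/asboolP; exists 0, (fun=> 0), (fun=> 0); split; first by case.
  by rewrite big_ord0.
apply/asboolP; exists (m + p)%N.
exists (fun i => match split i with inl j => a * c j | inr j => d j end).
exists (fun i => match split i with inl j => v j | inr j => w j end).
split=> [i|]; first by case: (split i).
rewrite big_split_ord /= scaler_sumr; congr (_ + _); apply: eq_bigr => i _.
  by rewrite (unsplitK (inl i)) scalerA.
by rewrite (unsplitK (inr i)).
Qed.
HB.instance Definition _ := GRing.isSubmodClosed.Build K A plesken_pred
  plesken_submod_closed.

Record plesken : Type :=
  Plesken { plesken_val :> A; _ : plesken_pred plesken_val }.

HB.instance Definition _ := [isSub for plesken_val].
HB.instance Definition _ := [Choice of plesken by <:].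
HB.instance Definition _ := [SubChoice_isSubLmodule of plesken by <:].

Implicit Types x y z : plesken.

Fact plesken_anti x : sigma (plesken_val x) = - plesken_val x.
Proof.
case: x => x /= /asboolP [m [c [v [vS ->]]]].
rewrite linear_sum -sumrN; apply: eq_bigr => i _.
by case: (vS i) => a _ <-; rewrite linearZ linearB /= antiinvK -scalerN opprB.
Qed.

Fact plesken_lie_subproof x y :
  plesken_pred (commutator (plesken_val x) (plesken_val y)).
Proof.
apply/asboolP; exists 1%N, (fun=> 1).
exists (fun=> commutator (plesken_val x) (plesken_val y)).
split=> [_|]; last by rewrite big_ord1 scale1r.
exists (plesken_val x * plesken_val y) => //.
by rewrite antiinvM !plesken_anti mulrNN.
Qed.
Definition plesken_lie x y : plesken := Plesken (plesken_lie_subproof x y).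

Fact plesken_lie_linearl a x y z :
  plesken_lie (a *: x + y) z = a *: plesken_lie x z + plesken_lie y z.
Proof.
apply: val_inj; rewrite [LHS]/= [RHS]linearP /= commutatorDl.
by rewrite /commutator -scalerAl -scalerAr -scalerBr.
Qed.
Fact plesken_lie_linearr a x y z :
  plesken_lie z (a *: x + y) = a *: plesken_lie z x + plesken_lie z y.
Proof.
apply: val_inj; rewrite [LHS]/= [RHS]linearP /= commutatorDr.
by rewrite /commutator -scalerAl -scalerAr -scalerBr.
Qed.
Fact plesken_liexx x : plesken_lie x x = 0.
Proof. by apply: val_inj; apply: commutatorxx. Qed.
Fact plesken_lie_jacobi x y z :
  plesken_lie x (plesken_lie y z) + plesken_lie y (plesken_lie z x) +
    plesken_lie z (plesken_lie x y) = 0.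
Proof. by apply: val_inj; apply: commutator_jacobi. Qed.

HB.instance Definition _ := Lmodule_isLieAlgebra.Build K plesken
  plesken_lie_linearl plesken_lie_linearr plesken_liexx plesken_lie_jacobi.

End Plesken.

#[local] Close Scope classical_set_scope.

Section Diagrams.
Variable n : nat.
Implicit Types D E F : {set 'I_n * 'I_n}.

(* The pair (a, b) is the arc from the top node a to the bottom node b. *)
Definition no_common_endpoint D : bool :=
  [forall p in D, forall q in D, (p.1 == q.1) || (p.2 == q.2) ==> (p == q)].

Definition no_crossing D : bool :=
  [forall p in D, forall q in D, ~~ ((p.1 < q.1)%N && (q.2 < p.2)%N)].

Record diagram : Type := Diagram {
  arcs :> {set 'I_n * 'I_n};
  _ : no_common_endpoint arcs && no_crossing arcs
}.

HB.instance Definition _ := [isSub for arcs].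
HB.instance Definition _ := [Finite of diagram by <:].

Lemma planarP D :
  reflect (forall p q, p \in D -> q \in D -> (p.1 < q.1)%N = (p.2 < q.2)%N)
          (no_common_endpoint D && no_crossing D).
Proof.
apply: (iffP andP) => [[/forall_inP De /forall_inP Dc] p q pD qD | D1].
  have /forall_inP/(_ q qD)/implyP e := De p pD.
  have /forall_inP/(_ q qD) c1 := Dc p pD.
  have /forall_inP/(_ p pD) c2 := Dc q qD.
  apply/idP/idP => lt_pq; rewrite ltnNge leq_eqVlt;
    apply/negP => /orP[/eqP/val_inj eq_qp | lt_qp].
  - have pq : p = q by apply/eqP/e; rewrite eq_qp eqxx orbT.
    by rewrite pq ltnn in lt_pq.
  - by rewrite lt_pq lt_qp in c1.
  - have pq : p = q by apply/eqP/e; rewrite eq_qp eqxx.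
    by rewrite pq ltnn in lt_pq.
  - by rewrite lt_pq lt_qp in c2.
split; apply/forall_inP => p pD; apply/forall_inP => q qD.
  case: p q pD qD => [a b] [c d] pD qD /=.
  have /= := (D1 _ _ pD qD, D1 _ _ qD pD); rewrite xpair_eqE => -[].
  rewrite -!(inj_eq val_inj) /=.
  by case: (ltngtP a c); case: (ltngtP b d).
by have := D1 p q pD qD; case: ltngtP => //= _; case: ltngtP.
Qed.

Definition flip_arcs D : {set 'I_n * 'I_n} := [set p | (p.2, p.1) \in D].

Definition comp_arcs D E : {set 'I_n * 'I_n} :=
  [set p | [exists b, ((p.1, b) \in D) && ((b, p.2) \in E)]].

Definition id_arcs : {set 'I_n * 'I_n} := [set p | p.1 == p.2].

Fact flip_subproof (d : diagram) :
  no_common_endpoint (flip_arcs d) && no_crossing (flip_arcs d).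
Proof.
case: d => D /= /planarP D1; apply/planarP => p q; rewrite !inE => pD qD.
by rewrite (D1 _ _ pD qD).
Qed.
Fact comp_subproof (d e : diagram) :
  no_common_endpoint (comp_arcs d e) && no_crossing (comp_arcs d e).
Proof.
case: d e => [D /= /planarP D1] [E /= /planarP E1]; apply/planarP => p q.
rewrite !inE => /existsP[b /andP[pD pE]] /existsP[c /andP[qD qE]].
by rewrite (D1 _ _ pD qD) (E1 _ _ pE qE).
Qed.
Fact id_subproof : no_common_endpoint id_arcs && no_crossing id_arcs.
Proof. by apply/planarP => p q; rewrite !inE => /eqP-> /eqP->. Qed.

Definition flip (d : diagram) : diagram := Diagram (flip_subproof d).
Definition comp_diagram (d e : diagram) : diagram :=
  Diagram (comp_subproof d e).
Definition id_diagram : diagram := Diagram id_subproof.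

Lemma comp_diagramA : associative comp_diagram.
Proof.
move=> [D dD] [E dE] [F dF]; apply: val_inj; apply/setP => p; rewrite !inE /=.
apply/existsP/existsP => [[b /andP[bD]] | [c /andP[]]]; rewrite inE /=.
  case/existsP=> c /andP[bE cF]; exists c; rewrite cF andbT inE.
  by apply/existsP; exists b; rewrite bD.
case/existsP=> b /andP[bD bE] cF; exists b; rewrite bD inE /=.
by apply/existsP; exists c; rewrite bE.
Qed.
Lemma comp_id_diagram : left_id id_diagram comp_diagram.
Proof.
move=> [D dD]; apply: val_inj; apply/setP => -[a c]; rewrite !inE /=.
apply/existsP/idP => [[b /andP[]] | acD]; first by rewrite inE => /eqP /= <-.
by exists a; rewrite inE eqxx.
Qed.
Lemma comp_diagram_id : right_id id_diagram comp_diagram.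
Proof.
move=> [D dD]; apply: val_inj; apply/setP => -[a c]; rewrite !inE /=.
apply/existsP/idP => [[b /andP[abD]] | acD]; first by rewrite inE => /eqP /= <-.
by exists c; rewrite inE eqxx andbT.
Qed.
Lemma flip_comp d e : flip (comp_diagram d e) = comp_diagram (flip e) (flip d).
Proof.
apply: val_inj; apply/setP => p; rewrite !inE /=.
by apply: eq_existsb => b; rewrite !inE andbC.
Qed.
Lemma flipK : involutive flip.
Proof. by move=> d; apply: val_inj; apply/setP => -[a b]; rewrite !inE. Qed.

End Diagrams.

Section PlanarRookAlgebra.
Variables (K : fieldType) (n : nat).

(* An element is given by its coordinates in the basis of diagrams. *)
Definition PR : Type := {ffun diagram n -> K^o}.

HB.instance Definition _ := GRing.Lmodule.copy PR {ffun diagram n -> K^o}.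

Implicit Types (d e : diagram n) (f g h : PR).

Definition PR_basis d : PR := [ffun e => (e == d)%:R].

Definition PR_one : PR := PR_basis (id_diagram n).
Definition PR_mul f g : PR :=
  \sum_d \sum_e (f d * g e) *: PR_basis (comp_diagram d e).

Lemma PR_expand f : f = \sum_d f d *: PR_basis d.
Proof.
apply/ffunP => e; rewrite sum_ffunE (bigD1 e) //= big1 => [|d /negPf de].
  by rewrite addr0 !ffunE eqxx [RHS]mulr1.
by rewrite !ffunE eq_sym de [LHS]mulr0.
Qed.

Lemma PR_sum_basis (V : lmodType K) d (F : diagram n -> V) :
  \sum_e PR_basis d e *: F e = F d.
Proof.
rewrite (bigD1 d) //= big1 => [|e /negPf ed].
  by rewrite ffunE eqxx scale1r addr0.
by rewrite ffunE ed scale0r.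
Qed.

Lemma PR_sum_mul (V : lmodType K) f g (F : diagram n -> V) :
  \sum_x PR_mul f g x *: F x =
    \sum_d \sum_e (f d * g e) *: F (comp_diagram d e).
Proof.
transitivity (\sum_x \sum_d \sum_e
    (f d * g e) *: (PR_basis (comp_diagram d e) x *: F x)).
  apply: eq_bigr => x _; rewrite sum_ffunE scaler_suml; apply: eq_bigr => d _.
  rewrite sum_ffunE scaler_suml; apply: eq_bigr => e _.
  by rewrite scalerA ffunE.
rewrite exchange_big; apply: eq_bigr => d _; rewrite exchange_big.
by apply: eq_bigr => e _; rewrite -scaler_sumr PR_sum_basis.
Qed.

Fact PR_mulA : associative PR_mul.
Proof.
move=> f g h; rewrite [LHS]/PR_mul [RHS]/PR_mul.
transitivity (\sum_a \sum_b \sum_c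
    (f a * (g b * h c)) *: PR_basis (comp_diagram a (comp_diagram b c))).
  apply: eq_bigr => a _; under eq_bigr do rewrite -scalerA.
  rewrite -scaler_sumr PR_sum_mul scaler_sumr; apply: eq_bigr => b _.
  by rewrite scaler_sumr; apply: eq_bigr => c _; rewrite scalerA.
under [RHS]eq_bigr do (under eq_bigr do rewrite -scalerA; rewrite -scaler_sumr).
rewrite PR_sum_mul; apply: eq_bigr => a _; apply: eq_bigr => b _.
rewrite scaler_sumr; apply: eq_bigr => c _.
by rewrite scalerA mulrA comp_diagramA.
Qed.
Fact PR_mul1 : left_id PR_one PR_mul.
Proof.
move=> f; rewrite [LHS]/PR_mul.
under eq_bigr do (under eq_bigr do rewrite -scalerA; rewrite -scaler_sumr).
rewrite PR_sum_basis [RHS]PR_expand; apply: eq_bigr => e _.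
by rewrite comp_id_diagram.
Qed.
Fact PR_mulr1 : right_id PR_one PR_mul.
Proof.
move=> f; rewrite [LHS]/PR_mul [RHS]PR_expand; apply: eq_bigr => d _.
under eq_bigr do rewrite -scalerA.
by rewrite -scaler_sumr PR_sum_basis comp_diagram_id.
Qed.
Fact PR_mulDl : left_distributive PR_mul +%R.
Proof.
move=> f g h; rewrite -big_split; apply: eq_bigr => d _.
rewrite -big_split; apply: eq_bigr => e _.
by rewrite ffunE mulrDl scalerDl.
Qed.
Fact PR_mulDr : right_distributive PR_mul +%R.
Proof.
move=> f g h; rewrite -big_split; apply: eq_bigr => d _.
rewrite -big_split; apply: eq_bigr => e _.
by rewrite ffunE mulrDr scalerDl.
Qed.
Fact PR_one_neq0 : PR_one != 0.
Proof.
by apply/eqP => /ffunP/(_ (id_diagram n))/eqP; rewrite !ffunE eqxx oner_eq0.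
Qed.

HB.instance Definition _ := GRing.Zmodule_isNzRing.Build PR
  PR_mulA PR_mul1 PR_mulr1 PR_mulDl PR_mulDr PR_one_neq0.

Fact PR_scaleAl (a : K) f g : a *: (f * g) = (a *: f) * g.
Proof.
rewrite scaler_sumr; apply: eq_bigr => d _.
rewrite scaler_sumr; apply: eq_bigr => e _.
by rewrite scalerA mulrA ffunE.
Qed.
HB.instance Definition _ := GRing.Lmodule_isLalgebra.Build K PR PR_scaleAl.

Fact PR_scaleAr (a : K) f g : a *: (f * g) = f * (a *: g).
Proof.
rewrite scaler_sumr; apply: eq_bigr => d _.
rewrite scaler_sumr; apply: eq_bigr => e _.
by rewrite scalerA mulrCA ffunE.
Qed.
HB.instance Definition _ := GRing.Lalgebra_isAlgebra.Build K PR PR_scaleAr.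

Lemma PR_basisM d e : PR_basis d * PR_basis e = PR_basis (comp_diagram d e).
Proof.
rewrite -[LHS]/(PR_mul _ _) /PR_mul.
under eq_bigr do (under eq_bigr do rewrite -scalerA; rewrite -scaler_sumr).
by rewrite !PR_sum_basis.
Qed.

Definition PR_flip f : PR := \sum_d f d *: PR_basis (flip d).

Fact PR_flip_linear : linear PR_flip.
Proof.
move=> a f g; rewrite /PR_flip scaler_sumr -big_split; apply: eq_bigr => d _.
by rewrite !ffunE scalerDl scalerA.
Qed.
HB.instance Definition _ := GRing.isLinear.Build K PR PR *:%R PR_flip
  PR_flip_linear.

Lemma PR_flip_basis d : PR_flip (PR_basis d) = PR_basis (flip d).
Proof. exact: PR_sum_basis. Qed.

Fact PR_flipM f g : PR_flip (f * g) = PR_flip g * PR_flip f.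
Proof.
rewrite [LHS]PR_sum_mul [in RHS]/PR_flip mulr_suml exchange_big.
apply: eq_bigr => e _; rewrite -scalerAl mulr_sumr scaler_sumr.
apply: eq_bigr => d _.
by rewrite -scalerAr scalerA PR_basisM flip_comp mulrC.
Qed.
Fact PR_flipK : involutive PR_flip.
Proof.
move=> f; rewrite [X in PR_flip X]/PR_flip linear_sum [RHS]PR_expand.
by apply: eq_bigr => d _; rewrite linearZ /= PR_flip_basis flipK.
Qed.
HB.instance Definition _ := isAntiInvolution.Build K PR PR_flip
  PR_flipM PR_flipK.

End PlanarRookAlgebra.

(* Main.v *)
From HB Require Import structures.
Require Import Defs.
From mathcomp Require Import all_boot all_algebra reals complex.
From mathcomp Require Import boolp.

(* For subsets S, T of {1..n} of equal size let e(S,T) be the unique planar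
   diagram with top endpoints S and bottom endpoints T.  Sending a diagram d to
   the matrices indexed by k-subsets whose (S,T) entry is 1 if e(S,T) is
   contained in d and 0 otherwise is multiplicative, because e(S,T) is contained
   in d exactly when d is defined on S and carries it onto T.  On coordinates
   this is the zeta transform of the inclusion order on diagrams, which is
   unitriangular, so PR(n) is isomorphic to the product of the matrix algebras
   of sizes binomial(n,k).  Since flipping e(S,T) gives e(T,S), the flip becomes
   transposition, and the Plesken Lie algebra, which is the (-1)-eigenspace of
   the flip when 2 is invertible, becomes the product of the skew-symmetric
   matrices. *)

Set Implicit Arguments.
Unset Strict Implicit.
Unset Printing Implicit Defensive.

Import GRing.Theory Num.Theory.

Local Open Scope ring_scope.

(** * Diagrams as increasing partial injections, and their standard form *)

Section StandardDiagram.
Variable n : nat.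
Implicit Types (d e : diagram n) (S T U : {set 'I_n}) (a b c : 'I_n).

Lemma diagram_mono d a a' b b' :
  (a, b) \in arcs d -> (a', b') \in arcs d -> (a < a')%N = (b < b')%N.
Proof. by case: d => D /= /planarP h p q; have := h _ _ p q. Qed.

Lemma diagram_fun d a b b' :
  (a, b) \in arcs d -> (a, b') \in arcs d -> b = b'.
Proof.
move=> p q; have := diagram_mono p q; have := diagram_mono q p.
by rewrite ltnn; case: ltngtP => // /val_inj.
Qed.

Lemma diagram_inj d a a' b :
  (a, b) \in arcs d -> (a', b) \in arcs d -> a = a'.
Proof.
move=> p q; have := diagram_mono p q; have := diagram_mono q p.
by rewrite ltnn; case: ltngtP => // /val_inj.
Qed.

Definition top d : {set 'I_n} := [set p.1 | p in arcs d].
Definition bottom d : {set 'I_n} := [set p.2 | p in arcs d].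
Definition image_below d S : {set 'I_n} :=
  [set b | [exists a in S, (a, b) \in arcs d]].

Lemma topP d a : reflect (exists b, (a, b) \in arcs d) (a \in top d).
Proof.
apply: (iffP imsetP) => [[[a' b] p ->] | [b p]]; first by exists b.
by exists (a, b).
Qed.

Lemma bottomP d b : reflect (exists a, (a, b) \in arcs d) (b \in bottom d).
Proof.
apply: (iffP imsetP) => [[[a b'] p ->] | [a p]]; first by exists a.
by exists (a, b).
Qed.

Lemma image_belowP d S b :
  reflect (exists2 a, a \in S & (a, b) \in arcs d) (b \in image_below d S).
Proof. by rewrite inE; apply: exists_inP. Qed.

Lemma card_fst d (L : {set 'I_n * 'I_n}) :
  L \subset arcs d -> #|[set p.1 | p in L]| = #|L|.
Proof.
move=> /subsetP Ld; apply: card_in_imset => -[a b] [a' b'] /Ld p /Ld q /= aa'.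
by subst a'; rewrite (diagram_fun p q).
Qed.

Lemma card_snd d (L : {set 'I_n * 'I_n}) :
  L \subset arcs d -> #|[set p.2 | p in L]| = #|L|.
Proof.
move=> /subsetP Ld; apply: card_in_imset => -[a b] [a' b'] /Ld p /Ld q /= bb'.
by subst b'; rewrite (diagram_inj p q).
Qed.

Lemma card_top_bottom d : #|top d| = #|bottom d|.
Proof. by rewrite (card_fst (subxx _)) (card_snd (subxx _)). Qed.

(** On [S] this is the increasing bijection onto 0, ..., [#|S|] - 1, so joining in increasing order
    means joining nodes of equal rank. *)
Definition rank S a : nat := #|[set c in S | (c < a)%N]|.

Lemma rank_ltn S a a' :
  a \in S -> a' \in S -> (rank S a < rank S a')%N = (a < a')%N.
Proof.
have mono (x y : 'I_n) : x \in S -> (x < y)%N -> (rank S x < rank S y)%N.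
  move=> xS xy; apply/proper_card/properP; split.
    by apply/subsetP => c; rewrite !inE => /andP[-> /ltn_trans->].
  by exists x; rewrite !inE xS ?ltnn.
move=> aS a'S; apply/idP/idP => [|/mono]; last exact.
case: (ltngtP a a') => // [/(mono _ _ a'S)|/val_inj->]; last by rewrite ltnn.
by move/ltnW; rewrite leqNgt => /negPf->.
Qed.

Lemma rank_inj S : {in S &, injective (rank S)}.
Proof.
move=> a a' aS a'S r; have := rank_ltn aS a'S; have := rank_ltn a'S aS.
by rewrite r ltnn; case: ltngtP => // /val_inj.
Qed.

Lemma rank_bound S a : a \in S -> (rank S a < #|S|)%N.
Proof.
move=> aS; apply/proper_card/properP; split.
  by apply/subsetP => c; rewrite inE => /andP[].
by exists a; rewrite // inE ltnn andbF.
Qed.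

(** An injection between finite sets of equal size is onto. *)
Lemma rank_surj S r : (r < #|S|)%N -> exists2 a, a \in S & rank S a = r.
Proof.
move=> rS; pose f (a : {a | a \in S}) := Ordinal (rank_bound (valP a)).
have f_inj : injective f.
  by move=> a b [] r_eq; apply/val_inj/(rank_inj (valP a) (valP b)).
have fE : #|'I_#|S| | = #|{: {a | a \in S}}| by rewrite card_ord card_sig.
have /codomP[a aE] : Ordinal rS \in codom f.
  by apply: inj_card_onto => //; rewrite fE.
by exists (val a); [exact: valP | case: aE].
Qed.

(** Both ranks count the arcs to the left of (a, b): by monotonicity, left at the top means left at
    the bottom. *)
Lemma rank_arc d a b : (a, b) \in arcs d -> rank (top d) a = rank (bottom d) b.
Proof.
move=> abd; pose L := [set p in arcs d | (p.1 < a)%N].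
have Ld : L \subset arcs d by apply/subsetP => p; rewrite inE => /andP[].
have LE p : (p \in L) = (p \in arcs d) && (p.2 < b)%N.
  case: p => x y; rewrite inE; apply: andb_id2l => xyd.
  exact: diagram_mono xyd abd.
transitivity #|L|; [rewrite -(card_fst Ld) | rewrite -(card_snd Ld)].
  congr #|pred_of_set _|; apply/setP => c; rewrite inE; apply/andP/imsetP.
    by case=> /topP[y cy] ca; exists (c, y); rewrite // inE cy.
  case=> -[x y]; rewrite inE => /andP[xy xa] ->; split => //.
  by apply/topP; exists y.
congr #|pred_of_set _|; apply/setP => c; rewrite inE; apply/imsetP/andP.
  case=> -[x y]; rewrite LE => /andP[xy xa] ->; split => //.
  by apply/bottomP; exists x.
by case=> /bottomP[x xc] cb; exists (x, c); rewrite // LE xc.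
Qed.

(** If the sizes differ, only ranks occurring in both sets are joined; the result is still planar,
    so [std] is total. *)
Definition std_arcs S T : {set 'I_n * 'I_n} :=
  [set p | [&& p.1 \in S, p.2 \in T & rank S p.1 == rank T p.2]].

Fact std_subproof S T :
  no_common_endpoint (std_arcs S T) && no_crossing (std_arcs S T).
Proof.
apply/planarP => -[a b] [a' b']; rewrite !inE /=.
move=> /and3P[aS bT /eqP r] /and3P[a'S b'T /eqP r'].
by rewrite -(rank_ltn aS a'S) -(rank_ltn bT b'T) r r'.
Qed.

Definition std S T : diagram n := Diagram (std_subproof S T).

Lemma top_std S T : #|S| = #|T| -> top (std S T) = S.
Proof.
move=> ST; apply/setP => a; apply/topP/idP => [[b]|aS].
  by rewrite inE => /andP[].
have [|b bT r] := @rank_surj T (rank S a); first by rewrite -ST rank_bound.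
by exists b; rewrite inE /= aS bT r eqxx.
Qed.

Lemma bottom_std S T : #|S| = #|T| -> bottom (std S T) = T.
Proof.
move=> ST; apply/setP => b; apply/bottomP/idP => [[a]|bT].
  by rewrite inE => /and3P[].
have [|a aS r] := @rank_surj S (rank T b); first by rewrite ST rank_bound.
by exists a; rewrite inE /= aS bT r eqxx.
Qed.

Lemma stdE d : std (top d) (bottom d) = d.
Proof.
apply: val_inj; apply/setP => -[a b]; rewrite inE /=.
apply/and3P/idP => [[/topP[b' ab'] bd /eqP r] | ab].
  (* The true partner [b'] of [a] has the same rank as [b], hence equals it. *)
  rewrite (rank_arc ab') in r.
  by rewrite -(@rank_inj (bottom d) b' b) //; apply/bottomP; exists a.
split; first by apply/topP; exists b.
  by apply/bottomP; exists a.
by apply/eqP/rank_arc.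
Qed.

Lemma flip_std S T : flip (std S T) = std T S.
Proof.
apply: val_inj; apply/setP => -[a b]; rewrite !inE /=.
by rewrite andbCA eq_sym.
Qed.

Lemma flip_sub d e :
  (arcs (flip d) \subset arcs e) = (arcs d \subset arcs (flip e)).
Proof.
apply/subsetP/subsetP => sub [a b] p; rewrite ?inE.
  by apply: sub; rewrite inE.
by have := sub (b, a); rewrite !inE /= in p *; apply.
Qed.

(** The arcs starting in [S] project injectively to both rows, onto [S] and onto its image. *)
Lemma card_image_below d S : S \subset top d -> #|image_below d S| = #|S|.
Proof.
move=> sub; pose L := [set p in arcs d | p.1 \in S].
have Ld : L \subset arcs d by apply/subsetP => p; rewrite inE => /andP[].
transitivity #|L|; [rewrite -(card_snd Ld) | rewrite -(card_fst Ld)].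
  congr #|pred_of_set _|; apply/setP => b; apply/image_belowP/imsetP.
    by case=> a aS ab; exists (a, b); rewrite // inE ab.
  by case=> -[x y]; rewrite inE => /andP[xy xS] ->; exists x.
congr #|pred_of_set _|; apply/setP => a; apply/imsetP/idP.
  by case=> -[x y]; rewrite inE => /andP[xy xS] ->.
move=> aS; have /topP[b ab] := subsetP sub a aS.
by exists (a, b); rewrite // inE ab.
Qed.

Lemma std_sub d S T : #|S| = #|T| ->
  (arcs (std S T) \subset arcs d) = (S \subset top d) && (image_below d S == T).
Proof.
move=> ST; apply/idP/andP => [/subsetP sub | [Sd /eqP ST']].
  have arcS a : a \in S -> exists2 b, b \in T & (a, b) \in arcs d.
    rewrite -{1}(top_std ST) => /topP[b ab]; exists b; last exact: sub.
    by move: ab; rewrite inE => /and3P[].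
  split; first by apply/subsetP => a /arcS[b _ ab]; apply/topP; exists b.
  apply/eqP/setP => b; apply/image_belowP/idP => [[a aS ab]|].
    by have [b' b'T /(diagram_fun ab) ->] := arcS a aS.
  rewrite -{1}(bottom_std ST) => /bottomP[a ab]; exists a; last exact: sub.
  by move: ab; rewrite inE => /and3P[].
(* The restriction of [d] to [S] is a planar diagram with top [S] and bottom [T], so by [stdE] it is
   [std S T]. *)
pose L := [set p in arcs d | p.1 \in S].
have LP : no_common_endpoint L && no_crossing L.
  apply/planarP => -[a b] [a' b']; rewrite !inE => /andP[p _] /andP[q _].
  exact: diagram_mono p q.
have topL : top (Diagram LP) = S.
  apply/setP => a; apply/topP/idP => [[b]|aS]; first by rewrite inE => /andP[].
  by have /topP[b ab] := subsetP Sd a aS; exists b; rewrite inE ab.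
have bottomL : bottom (Diagram LP) = T.
  rewrite -ST'; apply/setP => b; apply/bottomP/image_belowP => -[a].
    by rewrite inE => /andP[]; exists a.
  by move=> aS ab; exists a; rewrite inE ab.
rewrite -topL -bottomL stdE; apply/subsetP => p; by rewrite inE => /andP[].
Qed.

(** * Composition of diagrams as composition of partial maps *)

Lemma comp_arcP d e a c :
  reflect (exists2 b, (a, b) \in arcs d & (b, c) \in arcs e)
          ((a, c) \in arcs (comp_diagram d e)).
Proof.
rewrite inE; apply: (iffP existsP) => [[b /andP[]]|[b p q]]; first by exists b.
by exists b; rewrite p q.
Qed.

Lemma image_below_comp d e S :
  image_below (comp_diagram d e) S = image_below e (image_below d S).
Proof.
apply/setP => c; apply/image_belowP/image_belowP => -[].
  by move=> a aS /comp_arcP[b ab bc]; exists b => //; apply/image_belowP; exists a.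
by move=> b /image_belowP[a aS ab] bc; exists a => //; apply/comp_arcP; exists b.
Qed.

Lemma sub_top_comp d e S :
  (S \subset top (comp_diagram d e)) =
  (S \subset top d) && (image_below d S \subset top e).
Proof.
apply/idP/andP => [/subsetP sub | [/subsetP Sd /subsetP Te]].
  split; apply/subsetP => b.
    by move=> /sub/topP[c /comp_arcP[b' bb' _]]; apply/topP; exists b'.
  case/image_belowP=> a /sub/topP[c /comp_arcP[b' ab' b'c]] ab.
  by apply/topP; exists c; rewrite (diagram_fun ab ab').
apply/subsetP => a aS; have /topP[b ab] := Sd a aS.
have /topP[c bc] : b \in top e by apply: Te; apply/image_belowP; exists a.
by apply/topP; exists c; apply/comp_arcP; exists b.
Qed.

End StandardDiagram.

(** * Unit diagrams indexed by pairs of k-subsets *)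

Section Subsets.
Variables (n k : nat).

Definition ksubsets : {set {set 'I_n}} := [set S : {set 'I_n} | #|S| == k].

Lemma card_ksubsets : #|ksubsets| = 'C(n, k).
Proof. by rewrite card_draws card_ord. Qed.

Definition ksubset (i : 'I_'C(n, k)) : {set 'I_n} :=
  enum_val (cast_ord (esym card_ksubsets) i).

Lemma card_ksubset i : #|ksubset i| = k.
Proof. by have := enum_valP (cast_ord (esym card_ksubsets) i); rewrite inE => /eqP. Qed.

Lemma ksubset_inj : injective ksubset.
Proof. by move=> i j /enum_val_inj/cast_ord_inj. Qed.

Lemma ksubset_surj (S : {set 'I_n}) : #|S| = k -> exists i, ksubset i = S.
Proof.
move=> Sk; have SP : S \in ksubsets by rewrite inE Sk.
exists (cast_ord card_ksubsets (enum_rank_in SP S)).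
by rewrite /ksubset cast_ordK enum_rankK_in.
Qed.

Definition unit_diagram (i j : 'I_'C(n, k)) : diagram n :=
  std (ksubset i) (ksubset j).

Lemma flip_unit i j : flip (unit_diagram i j) = unit_diagram j i.
Proof. exact: flip_std. Qed.

(** Only the index [l] of the image of [ksubset i] under [d] can contribute; this image has size k
    once [ksubset i] lies in the top of [d]. *)
Lemma unit_sub_comp (K : pzRingType) (d e : diagram n) i j :
  (arcs (unit_diagram i j) \subset arcs (comp_diagram d e))%:R =
  \sum_l (arcs (unit_diagram i l) \subset arcs d)%:R *
         (arcs (unit_diagram l j) \subset arcs e)%:R :> K.
Proof.
have subE x y z : (arcs (unit_diagram x y) \subset arcs z) =
    (ksubset x \subset top z) && (image_below z (ksubset x) == ksubset y).
  by rewrite std_sub // !card_ksubset.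
rewrite subE sub_top_comp image_below_comp.
have [Sd|Sd] := boolP (ksubset i \subset top d); last first.
  by rewrite big1 // => l _; rewrite subE (negPf Sd) mul0r.
have [l lE] : exists l, ksubset l = image_below d (ksubset i).
  by apply: ksubset_surj; rewrite card_image_below ?card_ksubset.
rewrite (bigD1 l) //= big1 => [|m /negPf ml].
  by rewrite !subE Sd lE eqxx mul1r addr0.
by rewrite subE Sd -lE (inj_eq ksubset_inj) eq_sym ml mul0r.
Qed.

End Subsets.

(** * Every diagram is a unit diagram in exactly one way *)

Section UnitDiagrams.
Variable n : nat.

(** The entry positions of all matrix blocks together. *)
Definition unit_index : Type := {k : 'I_n.+1 & ('I_'C(n, k) * 'I_'C(n, k))%type}.

Definition unit_triple (k : 'I_n.+1) (i j : 'I_'C(n, k)) : unit_index :=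
  Tagged (fun k : 'I_n.+1 => ('I_'C(n, k) * 'I_'C(n, k))%type) (i, j).

Definition unit_of (p : unit_index) : diagram n :=
  unit_diagram (tagged p).1 (tagged p).2.

(** The endpoints recover both subsets, and their size recovers the block. *)
Lemma unit_of_inj : injective unit_of.
Proof.
move=> [k [i j]] [k' [i' j']]; rewrite /unit_of /= => eq_u.
have eqS : ksubset i = ksubset i'.
  by have := congr1 (@top n) eq_u; rewrite !top_std ?card_ksubset.
have eqT : ksubset j = ksubset j'.
  by have := congr1 (@bottom n) eq_u; rewrite !bottom_std ?card_ksubset.
have kk' : k = k' by apply: val_inj; rewrite /= -(card_ksubset i) eqS card_ksubset.
by subst k'; rewrite (ksubset_inj eqS) (ksubset_inj eqT).
Qed.

Lemma unit_of_surj d : exists p, unit_of p = d.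
Proof.
have topk : (#|top d| < n.+1)%N by rewrite ltnS -[leqRHS]card_ord max_card.
have [i iE] := @ksubset_surj n (Ordinal topk) (top d) erefl.
have [j jE] := @ksubset_surj n (Ordinal topk) (bottom d) (esym (card_top_bottom d)).
by exists (unit_triple i j); rewrite /unit_of /unit_diagram /= iE jE stdE.
Qed.

Lemma unit_of_bij : bijective unit_of.
Proof.
apply: inj_card_bij unit_of_inj _; rewrite -(card_image unit_of_inj).
by apply/subset_leq_card/subsetP => d _; have [p <-] := unit_of_surj d; apply: codom_f.
Qed.

End UnitDiagrams.

(** * The zeta transform and its compatibility with product and flip *)

Section Zeta.
Variables (K : fieldType) (n : nat).
Implicit Types (x y : PR K n) (d e : diagram n).

Definition zeta x : PR K n :=
  [ffun e : diagram n => \sum_(d | arcs e \subset arcs d) x d].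

(** With the inclusion test as a vector of [K^o], [PR_sum_mul] and [PR_sum_basis] apply. *)
Lemma zetaE x e : zeta x e = \sum_d x d *: ((arcs e \subset arcs d)%:R : K^o).
Proof.
rewrite ffunE big_mkcond; apply: eq_bigr => d _.
by case: ifP => _; rewrite ?scaler0 // [RHS]mulr1.
Qed.

Fact zeta_linear : linear zeta.
Proof.
move=> a x y; apply/ffunP => e; rewrite !ffunE scaler_sumr -big_split.
by apply: eq_bigr => d _; rewrite !ffunE.
Qed.
HB.instance Definition _ :=
  GRing.isLinear.Build K (PR K n) (PR K n) *:%R zeta zeta_linear.

Lemma zeta_eq0 x : zeta x = 0 -> x = 0.
Proof.
move=> zx; apply/ffunP => d; rewrite ffunE.
(* Induction on the number of pairs outside [d]: the coefficients of strictly larger diagrams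
   vanish, so the equation at [d] leaves only [x d]. *)
have [m] := ubnP (#|~: arcs d|); elim: m d => // m IHm d.
rewrite ltnS => dm; have := congr1 (fun f : PR K n => f d) zx.
rewrite !ffunE (bigD1 d) //= big1 ?addr0 // => e /andP[de ed].
apply/IHm/(leq_trans _ dm)/proper_card.
by rewrite properC properEneq de andbT; apply: contra ed => /eqP/val_inj->.
Qed.

Lemma zeta_bij : bijective zeta.
Proof.
(* In finite dimension an endomorphism with zero kernel is invertible. *)
pose V : vectType K := {ffun diagram n -> K^o}.
pose f : 'End(V) := linfun (zeta : {linear V -> V}).
have kf : lker f == 0%VS.
  by apply/lker0P => x y; rewrite !lfunE /= => /eqP;
    rewrite -subr_eq0 -linearB => /eqP/zeta_eq0/eqP; rewrite subr_eq0 => /eqP.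
exists (f^-1)%VF => x.
  by have := lker0_lfunK kf x; rewrite lfunE.
by have := lker0_lfunVK kf x; rewrite lfunE.
Qed.

Lemma zeta_flip x e : zeta (PR_flip x) e = zeta x (flip e).
Proof.
rewrite /PR_flip linear_sum sum_ffunE [RHS]ffunE [RHS]big_mkcond.
apply: eq_bigr => d _; rewrite linearZ ffunE zetaE PR_sum_basis flip_sub.
by case: ifP => _; [exact: mulr1 | exact: mulr0].
Qed.

(** Bilinear expansion reduces this to pairs of diagrams, where it is [unit_sub_comp]. *)
Lemma zeta_mul x y k (i j : 'I_'C(n, k)) :
  zeta (x * y) (unit_diagram i j) =
  \sum_l (zeta x (unit_diagram i l) : K) * zeta y (unit_diagram l j).
Proof.
rewrite zetaE PR_sum_mul.
under [RHS]eq_bigr do rewrite !zetaE mulr_suml.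
rewrite [RHS]exchange_big; apply: eq_bigr => d _.
under [RHS]eq_bigr do rewrite mulr_sumr.
rewrite [RHS]exchange_big; apply: eq_bigr => e _.
rewrite unit_sub_comp scaler_sumr; apply: eq_bigr => l _.
exact: mulrACA.
Qed.

End Zeta.

(** * From the Plesken Lie algebra to skew-symmetric blocks *)

Section Plesken.
Variables (K : fieldType) (n : nat).
Hypothesis two_neq0 : 2%:R != 0 :> K.
Local Notation L := (plesken (@PR_flip K n)).
Local Notation O := (lie_dsum (fun k : 'I_n.+1 => lie_o K 'C(n, k))).

Lemma plesken_predP (x : PR K n) :
  PR_flip x = - x -> plesken_pred (@PR_flip K n) x.
Proof.
(* If the flip negates [x], then [x] is half of [x - PR_flip x]. *)
move=> xN; apply/asboolP; exists 1%N, (fun=> 2%:R^-1), (fun=> x - PR_flip x).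
split=> [_|]; first by exists x.
by rewrite big_ord1 xN opprK -mulr2n -scaler_nat scalerA mulVf ?scale1r.
Qed.

Definition zeta_mx (x : PR K n) k : 'M[K]_'C(n, k) :=
  \matrix_(i, j) zeta x (unit_diagram i j).

Lemma zeta_mxB x y k : zeta_mx (x - y) k = zeta_mx x k - zeta_mx y k.
Proof. by apply/matrixP => i j; rewrite !mxE linearB !ffunE. Qed.

Lemma zeta_mxM x y k : zeta_mx (x * y) k = zeta_mx x k *m zeta_mx y k.
Proof.
apply/matrixP => i j; rewrite !mxE zeta_mul.
by apply: eq_bigr => l _; rewrite !mxE.
Qed.

Fact zeta_mx_skew (x : L) k : skew_symmetric (zeta_mx (plesken_val x) k).
Proof.
apply/eqP/matrixP => i j; rewrite !mxE -flip_unit -zeta_flip.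
by rewrite plesken_anti linearN ffunE.
Qed.

Definition plesken_orth (x : L) : O :=
  [ffun k : 'I_n.+1 => LieO (zeta_mx_skew x k)].

Fact plesken_orth_linear : linear plesken_orth.
Proof.
move=> a x y; apply/ffunP => k; rewrite !ffunE; apply: val_inj.
by apply/matrixP => i j; rewrite !mxE linearP !ffunE.
Qed.
HB.instance Definition _ :=
  GRing.isLinear.Build K L O *:%R plesken_orth plesken_orth_linear.

Lemma plesken_orth_lie x y :
  plesken_orth (lie x y) = lie (plesken_orth x) (plesken_orth y).
Proof.
apply/ffunP => k; rewrite !ffunE; apply: val_inj.
by rewrite /= zeta_mxB !zeta_mxM.
Qed.

Lemma plesken_orth_inj : injective plesken_orth.
Proof.
move=> x y /ffunP xy; apply/val_inj/(bij_inj (zeta_bij K n)).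
apply/ffunP => d; have [[k [i j]] <-] := unit_of_surj d.
have := congr1 val (xy k); rewrite ffunE [in RHS]ffunE => /matrixP/(_ i j).
by rewrite !mxE.
Qed.

Lemma plesken_orth_surj (y : O) : exists x, plesken_orth x = y.
Proof.
have [idx unitK _] := unit_of_bij n.
have [zeta' zetaK zeta'K] := zeta_bij K n.
(* The prescribed zeta transform: its value at a diagram is the entry of [y] at the position of that
   diagram. *)
pose w : PR K n := [ffun d => (orth_val (y (tag (idx d))))
  (tagged (idx d)).1 (tagged (idx d)).2].
have wE k i j : w (@unit_diagram n (nat_of_ord k) i j) = orth_val (y k) i j.
  by rewrite ffunE -[unit_diagram _ _]/(unit_of (unit_triple i j)) unitK.
have xP : plesken_pred (@PR_flip K n) (zeta' w).
  (* By injectivity of [zeta], the flip condition can be checked on [w], where it is skew-symmetry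
     of [y]. *)
  apply: plesken_predP; apply: (can_inj zetaK); apply/ffunP => d.
  rewrite zeta_flip linearN [RHS]ffunE /= !zeta'K.
  have [[k [i j]] <-] := unit_of_surj d; rewrite /unit_of /= flip_unit !wE.
  by have /eqP/matrixP/(_ i j) := valP (y k); rewrite !mxE.
exists (Plesken xP); apply/ffunP => k; rewrite ffunE; apply: val_inj.
by apply/matrixP => i j; rewrite mxE /= zeta'K wE.
Qed.

Lemma plesken_PR_isomorphic : lie_isomorphic L O.
Proof.
exists plesken_orth; split; last exact: plesken_orth_lie.
(* Chosen preimages give a right inverse; injectivity makes it two-sided. *)
have [g gK] := choice plesken_orth_surj.
by exists g => //; apply: inj_can_sym plesken_orth_inj.
Qed.

End Plesken.

Theorem corollary6p3 (R : realType) (n : nat) :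
  lie_isomorphic
    (plesken (@PR_flip R[i] n))
    (lie_dsum (fun k : 'I_n.+1 => lie_o R[i] 'C(n, k))).
(* Here 2 is nonzero because [R[i]] has characteristic zero. *)
Proof. by apply: plesken_PR_isomorphic; rewrite pnatr_eq0. Qed.
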